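(* Classically, the category $\mathbf{Ba}_{\bigvee}$ of Boolean algebras and maps preserving all existing joins is equivalent to the category $\mathbf{OOLat}$ of oo-lattices and oo-lattice morphisms.
   Context: ''Classically'' means in a classical setting (law of excluded middle and powerset axiom available). A map $f$ between Boolean algebras preserves all existing joins if whenever a family $(p_i)_{i\in I}$ has a join in the domain, $f(\bigvee_{i\in I} p_i)$ is the join of $(f(p_i))_{i\in I}$ in the codomain. An overlap lattice with opposite (oo-lattice) is a quadruple $(\mathcal P,\le,\bowtie,-)$ where $(\mathcal P,\le)$ is a bounded lattice (with bottom $0$ and top $1$), $-$ is a pseudo-complement operation ($p\wedge q=0\iff p\le -q$) and $\bowtie$ is a binary relation on $\mathcal P$ such that for all $p,q$: (symmetry) $p\bowtie q\Rightarrow q\bowtie p$; (meet closure) $p\bowtie q\Rightarrow p\bowtie(p\wedge q)$; (splitting of existing joins) whenever $(q_i)_{i\in I}$ is a set-indexed family whose join $\bigvee_{i\in I}q_i$ exists, $p\bowtie\bigvee_{i\in I}q_i\iff(\exists i\in I)(p\bowtie q_i)$; (density) $(\forall r\in\mathcal P)(r\bowtie p\Rightarrow r\bowtie q)\Rightarrow p\le q$. All oo-lattices are assumed set-based: there is a set $S$ of elements (a base) such that for every $p$ the join of $\{a\in S\mid a\le p\}$ exists and equals $p$. A morphism of oo-lattices from $\mathcal P$, with base $S$, to $\mathcal Q$ is a map $f:\mathcal P\to\mathcal Q$ such that for all $p\in\mathcal P$, $q\in\mathcal Q$: $f(p)\bowtie q\iff(\exists a\in S)\big(p\bowtie a\ \text{and}\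 (\forall x\in S)(x\bowtie a\Rightarrow f(x)\bowtie q)\big)$. Composition and identities are those of maps. *)

(* Defs.v *)
From mathcomp Require Import all_boot all_order.
From mathcomp Require Import boolp classical_sets.

Set Implicit Arguments.
Unset Strict Implicit.
Unset Printing Implicit Defensive.

Import Order.TTheory.

Local Open Scope order_scope.

Record category := Category {
  obj :> Type;
  hom : obj -> obj -> Type;
  idm : forall A, hom A A;
  compm : forall A B C, hom B C -> hom A B -> hom A C;
  compm1 : forall A B (f : hom A B), compm f (idm A) = f;
  comp1m : forall A B (f : hom A B), compm (idm B) f = f;
  compmA : forall A B C D (h : hom C D) (g : hom B C) (f : hom A B),
    compm h (compm g f) = compm (compm h g) f
}.
Arguments hom {c}.
Arguments idm {c}.
Arguments compm {c A B C}.

Record functor (C D : category) := Functor {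
  fobj :> C -> D;
  fhom : forall A B, hom A B -> hom (fobj A) (fobj B);
  fhom1 : forall A, fhom (idm A) = idm (fobj A);
  fhomM : forall A B E (g : hom B E) (f : hom A B),
    fhom (compm g f) = compm (fhom g) (fhom f)
}.
Arguments fhom {C D} _ {A B}.

Program Definition idF (C : category) : functor C C :=
  @Functor C C id (fun _ _ f => f) _ _.

Program Definition compF (C D E : category) (G : functor D E) (F : functor C D)
    : functor C E :=
  @Functor C E (fun A => G (F A)) (fun _ _ f => fhom G (fhom F f)) _ _.
Next Obligation. by rewrite !fhom1. Qed.
Next Obligation. by rewrite !fhomM. Qed.

Definition is_iso (C : category) (A B : C) (f : hom A B) : Prop :=
  exists g : hom B A, compm g f = idm A /\ compm f g = idm B.

Definition nat_isomorphic (C D : category) (F G : functor C D) : Prop :=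
  exists eta : forall A : C, hom (F A) (G A),
    (forall A, is_iso (eta A)) /\
    (forall (A B : C) (f : hom A B),
       compm (eta B) (fhom F f) = compm (fhom G f) (eta A)).

Definition equivalent_categories (C D : category) : Prop :=
  exists (F : functor C D) (G : functor D C),
    nat_isomorphic (compF G F) (idF C) /\ nat_isomorphic (compF F G) (idF D).

Definition is_join d (P : porderType d) (I : Type) (p : I -> P) (x : P) : Prop :=
  supremums (range p) x.

(* A display is only a notational tag of the order library; it is bundled so
   that the objects are all Boolean algebras. *)
Record boolAlg := BoolAlg {
  ba_disp : Order.disp_t;
  ba_sort :> ctbDistrLatticeType ba_disp
}.

(* The index types may be empty, so [f \bot = \bot] is included. *)
Definition preserves_joins (A B : boolAlg) (f : A -> B) : Prop :=
  forall (I : Type) (p : I -> A) (x : A),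
    is_join p x -> is_join (fun i => f (p i)) (f x).

Definition baMor (A B : boolAlg) := {f : A -> B | preserves_joins f}.

Definition ba_id (A : boolAlg) : baMor A A :=
  exist (@preserves_joins A A) (fun x => x) (fun _ _ _ px => px).

Definition ba_comp (A B C : boolAlg) (g : baMor B C) (f : baMor A B) : baMor A C :=
  exist (@preserves_joins A C) (fun x => sval g (sval f x))
    (fun I p x px => svalP g I _ _ (svalP f I p x px)).

Program Definition Ba : category := @Category boolAlg baMor ba_id ba_comp _ _ _.
Next Obligation. by case: f => f fP; exact: eq_exist. Qed.
Next Obligation. by case: f => f fP; exact: eq_exist. Qed.
Next Obligation. exact: eq_exist. Qed.

Definition is_base d (P : porderType d) (S : set P) : Prop :=
  forall p : P, supremums [set a | S a /\ a <= p]%classic p.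

Record ooLat := OOLattice {
  oo_disp : Order.disp_t;
  oo_sort :> tbLatticeType oo_disp;
  overlap : oo_sort -> oo_sort -> Prop;
  opposite : oo_sort -> oo_sort;
  oppositeP : forall p q, p `&` q = \bot <-> p <= opposite q;
  overlap_sym : forall p q, overlap p q -> overlap q p;
  overlap_meet : forall p q, overlap p q -> overlap p (p `&` q);
  overlap_join : forall (p : oo_sort) (I : Type) (q : I -> oo_sort) (x : oo_sort),
    is_join q x -> (overlap p x <-> exists i, overlap p (q i));
  overlap_dense : forall p q, (forall r, overlap r p -> overlap r q) -> p <= q;
  oo_set_based : exists S : set oo_sort, is_base S
}.
Arguments overlap {o}.
Arguments opposite {o}.

Declare Scope oo_scope.
Notation "p >o< q" := (overlap p q) (at level 70, no associativity) : oo_scope.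
Delimit Scope oo_scope with OO.
Local Open Scope oo_scope.

Definition is_ooMor_wrt (P Q : ooLat) (S : set P) (f : P -> Q) : Prop :=
  forall (p : P) (q : Q),
    f p >o< q <->
    exists a, S a /\ p >o< a /\ forall x, S x -> x >o< a -> f x >o< q.

(* The choice of base is irrelevant: see [is_ooMor_wrt_indep] below. *)
Definition is_ooMor (P Q : ooLat) (f : P -> Q) : Prop :=
  forall S : set P, is_base S -> is_ooMor_wrt S f.

Section OOTheory.
Implicit Types P Q R : ooLat.

Lemma overlap_le P (p x y : P) : x <= y -> p >o< x -> p >o< y.
Proof.
move=> xy px.
have jxy : is_join (fun b : bool => if b then x else y) y.
  split; first by move=> _ [[] _ <-].
  by move=> z zP; apply: zP; exists false.
by apply/(overlap_join p jxy); exists true.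
Qed.

Lemma overlap_base P (S : set P) : is_base S ->
  forall p q : P, p >o< q <-> exists a, S a /\ a <= q /\ p >o< a.
Proof.
move=> Sb p q; split; last by move=> [a [_ [aq]]]; exact: overlap_le.
have jq : is_join (fun a : {a | S a /\ a <= q} => sval a) q.
  rewrite /is_join (_ : range _ = [set a | S a /\ a <= q]%classic); first exact: Sb.
  by apply/seteqP; split=> [_ [[a aP] _ <-]//|a aP]; exists (exist _ a aP).
by move/(overlap_join p jq) => [[a [Sa aq]] /= pa]; exists a.
Qed.

Lemma is_ooMor_wrt_le P Q (S : set P) (f : P -> Q) :
  is_ooMor_wrt S f -> forall x y, x <= y -> f x <= f y.
Proof.
move=> fP x y xy; apply: overlap_dense => r /overlap_sym /fP [a [Sa [xa aP]]].
apply/overlap_sym/fP; exists a; split=> //; split=> //.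
exact/overlap_sym/(overlap_le xy)/overlap_sym.
Qed.

Lemma is_ooMor_wrt_indep P Q (S T : set P) (f : P -> Q) :
  is_base S -> is_base T -> is_ooMor_wrt S f -> is_ooMor_wrt T f.
Proof.
move=> Sb Tb fP p q; have fle := is_ooMor_wrt_le fP; split.
  move/fP => [a [Sa [pa aP]]].
  have /(overlap_base Tb) [b [Tb' [ba pb]]] := pa.
  exists b; split=> //; split=> // x _ xb.
  have /overlap_sym /(overlap_base Sb) [y [Sy [yx ay]]] := overlap_le ba xb.
  apply/overlap_sym/(overlap_le (fle _ _ yx))/overlap_sym.
  exact/aP/overlap_sym.
move=> [b [_ [pb bP]]]; apply/fP.
have /(overlap_base Sb) [a [Sa [ab pa]]] := pb.
exists a; split=> //; split=> // x _ xa.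
have /overlap_sym /(overlap_base Tb) [y [Ty [yx ay]]] := overlap_le ab xa.
apply/overlap_sym/(overlap_le (fle _ _ yx))/overlap_sym.
exact/bP/overlap_sym.
Qed.

Lemma is_ooMor_id P : is_ooMor (fun x : P => x).
Proof.
move=> S Sb p q; split.
  move/(overlap_base Sb) => [a [Sa [aq pa]]].
  by exists a; split=> //; split=> // x _; exact: overlap_le.
move=> [a [_ [/overlap_sym /(overlap_base Sb) [x [Sx [xp ax]]] aP]]].
exact/overlap_sym/(overlap_le xp)/overlap_sym/aP/overlap_sym.
Qed.

Lemma is_ooMor_comp P Q R (g : Q -> R) (f : P -> Q) :
  is_ooMor g -> is_ooMor f -> is_ooMor (fun x => g (f x)).
Proof.
move=> gP fP S Sb p r; have [T Tb] := oo_set_based Q.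
have gT := gP T Tb; have fS := fP S Sb.
split.
  move/gT => [b [Tb' [/fS [a [Sa [pa aP]]] bP]]].
  exists a; split=> //; split=> // x Sx xa.
  by apply/gT; exists b; split=> //; split=> //; exact: aP.
move=> [a [_ [/overlap_sym /(overlap_base Sb) [x [Sx [xp ax]]] aP]]].
have gle := is_ooMor_wrt_le gT; have fle := is_ooMor_wrt_le fS.
exact/overlap_sym/(overlap_le (gle _ _ (fle _ _ xp)))/overlap_sym/aP/overlap_sym.
Qed.

End OOTheory.

Definition ooMor (P Q : ooLat) := {f : P -> Q | is_ooMor f}.

Definition oo_id (P : ooLat) : ooMor P P := exist (@is_ooMor P P) (fun x => x) (@is_ooMor_id P).

Definition oo_comp (P Q R : ooLat) (g : ooMor Q R) (f : ooMor P Q) : ooMor P R :=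
  exist (@is_ooMor P R) (fun x => sval g (sval f x)) (is_ooMor_comp (svalP g) (svalP f)).

Program Definition OOLat : category := @Category ooLat ooMor oo_id oo_comp _ _ _.
Next Obligation. by case: f => f fP; exact: eq_exist. Qed.
Next Obligation. by case: f => f fP; exact: eq_exist. Qed.
Next Obligation. exact: eq_exist. Qed.

(* Main.v *)
(** On an oo-lattice, density and splitting of joins force, classically,
    [p >o< q <-> p `&` q <> \bot] and make the lattice Boolean, the opposite
    being the complement; conversely every Boolean algebra becomes an oo-lattice
    with this overlap. A map of oo-lattices is a morphism iff it preserves the
    existing joins. Hence both functors are the identity on carriers, orders and
    maps, and so are the components of both natural isomorphisms. *)
From HB Require Import structures.
From mathcomp Require Import all_boot all_order.
From mathcomp Require Import boolp classical_sets.
Require Import Defs.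

Set Implicit Arguments.
Unset Strict Implicit.
Unset Printing Implicit Defensive.

Import Order.TTheory Order.CTheory.

Local Open Scope order_scope.
Local Open Scope oo_scope.

Lemma is_joinP d (P : porderType d) (I : Type) (p : I -> P) (x : P) :
  is_join p x <->
  (forall i, p i <= x) /\ forall u, (forall i, p i <= u) -> x <= u.
Proof.
split=> [[ub lub]|[ub lub]].
  by split=> [i|u pu]; [apply: ub; exists i|apply: lub => _ [i _ <-]].
by split=> [_ [i _ <-]|u uP]; [exact: ub|apply: lub => i; apply: uP; exists i].
Qed.

Lemma is_join_pair d (L : latticeType d) (x y : L) :
  is_join (fun b : bool => if b then x else y) (x `|` y).
Proof.
apply/is_joinP; split=> [[]|u uP]; rewrite ?leUl ?leUr //.
by rewrite leUx (uP true) (uP false).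
Qed.

Lemma is_base_setT d (P : porderType d) : is_base [set: P].
Proof. by move=> p; split=> [a []|u]//; apply; split. Qed.

Section OOLattice.
Variable P : ooLat.
Implicit Types p q r x y z : P.

Lemma overlap_mono x y p q : x <= p -> y <= q -> x >o< y -> p >o< q.
Proof.
by move=> xp yq /(overlap_le yq)/overlap_sym/(overlap_le xp)/overlap_sym.
Qed.

Lemma overlap_meetxx p q : p >o< q -> p `&` q >o< p `&` q.
Proof.
move=> /overlap_meet/overlap_sym/overlap_meet; rewrite [_ `&` p]meetC.
by rewrite meetA meetxx.
Qed.

(** By [overlap_meetxx], either side makes the triple meet of [x], [y] and [z] overlap itself, and
    monotonicity recovers the other side. *)
Lemma overlap_meetA x y z : x >o< y `&` z <-> x `&` y >o< z.
Proof.
split=> /overlap_meetxx.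
  by apply: overlap_mono; [rewrite meetA leIl|rewrite meetA leIr].
by apply: overlap_mono; [rewrite -meetA leIl|rewrite -meetA leIr].
Qed.

(** [\bot] is the join of the empty family, so splitting would produce an index in [void]. *)
Lemma overlap_bot p : ~ p >o< \bot.
Proof.
have j0 : is_join (fun e : void => match e return P with end) \bot.
  by apply/is_joinP; split=> [[]|u _]; rewrite le0x.
by move/(overlap_join p j0) => [[]].
Qed.

Lemma overlap_join2 p x y : p >o< x `|` y <-> p >o< x \/ p >o< y.
Proof.
rewrite (overlap_join p (is_join_pair x y)); split=> [[[]]|[]]; try by [left|right].
  by exists true.
by exists false.
Qed.

(** If [p] and [q] do not overlap, nothing overlaps their meet, and density puts that meet below
    [\bot]. *)
Lemma overlapE p q : p >o< q <-> p `&` q <> \bot.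
Proof.
split=> [/overlap_meetxx pq pq0|pq0]; first by move: pq; rewrite pq0 => /overlap_bot.
apply: contrapT => Npq; apply: pq0; apply/eqP; rewrite -lex0.
apply: overlap_dense => r rpq; case: Npq.
by apply: overlap_mono (overlap_meetxx rpq); rewrite leIxr ?leIl ?leIr.
Qed.

Lemma le_oppositeE p q : p <= opposite q <-> ~ p >o< q.
Proof. by rewrite -oppositeP overlapE; split=> [-> /(_ erefl)|/contrapT]. Qed.

(** Density reduces the hard inequality to overlap with a test element [r]. There [z] can be moved
    over to [r], and the remaining binary join splits. *)
Lemma oo_meetUl : left_distributive (@Order.meet _ P) (@Order.join _ P).
Proof.
move=> x y z; apply/le_anti/andP; split; last by rewrite leUx !leI2 ?leUl ?leUr.
apply: overlap_dense => r.
by rewrite meetC overlap_meetA !overlap_join2 -!overlap_meetA ![z `&` _]meetC.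
Qed.

Lemma oo_joinxC p : p `|` opposite p = \top.
Proof.
apply/le_anti; rewrite lex1 /=; apply: overlap_dense => r rT.
(* Excluded middle: an [r] that does not overlap [p] lies below [opposite p], and it overlaps itself
   because it overlaps [\top]. *)
rewrite overlap_join2; have [rp|/le_oppositeE rp] := pselect (r >o< p); first by left.
by right; apply: overlap_mono (overlap_meetxx rT); rewrite meetx1.
Qed.

Lemma oo_meetxC p : p `&` opposite p = \bot.
Proof. by rewrite meetC oppositeP. Qed.

End OOLattice.

Lemma is_join_homo (A B : ooLat) (f : A -> B) :
  (forall (I : Type) (p : I -> A) x, is_join p x -> is_join (f \o p) (f x)) ->
  {homo f : x y / x <= y}.
Proof.
move=> fJ x y xy; have := is_join_pair x y; rewrite (join_r xy).
by move/fJ/is_joinP => [/(_ true)].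
Qed.

Lemma is_ooMorP (P Q : ooLat) (f : P -> Q) :
  is_ooMor f <->
  forall (I : Type) (p : I -> P) x, is_join p x -> is_join (fun i => f (p i)) (f x).
Proof.
split=> [fP I p x px|fJ].
  have fT := fP _ (@is_base_setT _ P); have fle := is_ooMor_wrt_le fT.
  apply/is_joinP; split=> [i|u uP]; first by apply: fle; case/is_joinP: px.
  (* The witness [a] overlaps the join [x], hence some [p i]; then [f (p i)] overlaps [r], and so
     does its upper bound [u]. *)
  apply: overlap_dense => r /overlap_sym/fT [a [_ [/overlap_sym xa aP]]].
  have /(overlap_join a px) [i /overlap_sym pia] := xa.
  exact/(overlap_le (uP i))/overlap_sym/aP.
have fle := is_join_homo fJ.
move=> S Sb; apply: (is_ooMor_wrt_indep (@is_base_setT _ P)) => // p q; split; last first.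
  move=> [a [_ [/overlap_meetxx pa aP]]].
  have : f (p `&` a) >o< q by apply: aP => //; exact: overlap_le (leIr _ _) pa.
  by apply: overlap_mono => //; apply: fle; exact: leIl.
move=> fpq; apply: contrapT => Na.
(* Without a witness, [p] is the join of the [p `&` x] with [f x] not
   overlapping [q], so [f p] would not overlap [q] either. *)
have pJ : is_join (fun x : {x | ~ f x >o< q} => p `&` sval x) p.
  apply/is_joinP; split=> [x|v vP]; first exact: leIl.
  apply: overlap_dense => r rp; apply: contrapT => Nrv; apply: Na.
  (* If [r] overlapped [p] but not [v], then [r] met with [p] would be the excluded witness: an [x]
     overlapping it with [f x] not overlapping [q] would make [r] overlap the meet of [p] and [x],
     which lies below [v]. *)
  exists (r `&` p); split=> //; split.
    by apply: overlap_mono (overlap_meetxx rp); rewrite ?leIr.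
  move=> x _; rewrite meetC overlap_meetA => xpr; apply: contrapT => Nfx.
  apply/Nrv/overlap_sym; apply: overlap_mono xpr => //.
  by rewrite meetC; exact: (vP (exist _ x Nfx)).
have /(overlap_join q (fJ _ _ _ pJ)) [[x Nfx] /= /overlap_sym fx] := overlap_sym fpq.
by apply: Nfx; apply: overlap_mono fx => //; apply: fle; exact: leIr.
Qed.

(* An alias, so that the Boolean structure has a key of its own. *)
Definition oo_carrier (P : ooLat) : Type := P.

HB.instance Definition _ (P : ooLat) := Order.TBLattice.on (oo_carrier P).
HB.instance Definition _ (P : ooLat) :=
  Order.Lattice_Meet_isDistrLattice.Build _ (oo_carrier P) (@oo_meetUl P).
HB.instance Definition _ (P : ooLat) :=
  Order.TBDistrLattice_hasComplement.Build _ (oo_carrier P)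
    (@oo_joinxC P) (@oo_meetxC P).

Definition ba_of_oo (P : ooLat) : boolAlg := @BoolAlg _ (oo_carrier P).

Section BooleanOverlap.
Variable A : boolAlg.
Implicit Types p q r : A.

Let ov p q := p `&` q <> \bot.

Fact ba_oppositeP p q : p `&` q = \bot <-> p <= ~` q.
Proof. by rewrite -disj_leC; split=> /eqP. Qed.

Fact ba_overlap_sym p q : ov p q -> ov q p.
Proof. by rewrite /ov meetC. Qed.

Fact ba_overlap_meet p q : ov p q -> ov p (p `&` q).
Proof. by rewrite /ov meetA meetxx. Qed.

(** If [p] is disjoint from every [q i], then the complement of [p] is an upper bound of the family,
    so it lies above the join [x]. *)
Fact ba_overlap_join p (I : Type) (q : I -> A) x :
  is_join q x -> (ov p x <-> exists i, ov p (q i)).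
Proof.
move=> /is_joinP[ub lub]; split=> [px|[i pqi] px].
  apply: contrapT => /forallNP Npq; apply: px.
  rewrite meetC ba_oppositeP; apply: lub => i; rewrite -ba_oppositeP meetC.
  exact: contrapT (Npq i).
by apply/pqi/eqP; rewrite -lex0 -px leI2.
Qed.

Fact ba_overlap_dense p q : (forall r, ov r p -> ov r q) -> p <= q.
Proof.
move=> pq; rewrite -[q]complK -ba_oppositeP; apply: contrapT => pCq.
(* The complement of [q] is the test element: it would overlap [p] but cannot overlap [q]. *)
have := pq (~` q); rewrite /ov meetC => /(_ pCq); apply.
by rewrite meetC meetxC.
Qed.

Definition oo_of_ba : ooLat :=
  @OOLattice _ A ov (fun p => ~` p) ba_oppositeP ba_overlap_sym ba_overlap_meet
    ba_overlap_join ba_overlap_dense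
    (ex_intro _ _ (@is_base_setT _ A)).

End BooleanOverlap.

Definition oo_of_ba_hom (A B : boolAlg) (f : baMor A B) :
    ooMor (oo_of_ba A) (oo_of_ba B) :=
  exist (@is_ooMor (oo_of_ba A) (oo_of_ba B)) (sval f)
    (proj2 (@is_ooMorP (oo_of_ba A) (oo_of_ba B) (sval f)) (svalP f)).

Definition ba_of_oo_hom (P Q : ooLat) (f : ooMor P Q) :
    baMor (ba_of_oo P) (ba_of_oo Q) :=
  exist (@preserves_joins (ba_of_oo P) (ba_of_oo Q)) (sval f)
    (proj1 (is_ooMorP (sval f)) (svalP f)).

Program Definition oo_of_ba_functor : functor Ba OOLat :=
  @Functor Ba OOLat oo_of_ba oo_of_ba_hom _ _.
Next Obligation. exact: eq_exist. Qed.
Next Obligation. exact: eq_exist. Qed.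

Program Definition ba_of_oo_functor : functor OOLat Ba :=
  @Functor OOLat Ba ba_of_oo ba_of_oo_hom _ _.
Next Obligation. exact: eq_exist. Qed.
Next Obligation. exact: eq_exist. Qed.

Theorem corollary4p12 : equivalent_categories Ba OOLat.
Proof.
exists oo_of_ba_functor, ba_of_oo_functor; split.
  (* The round trip has the same carrier and order as [A] by computation, so a join on one side is
     literally a join on the other. *)
  exists (fun A : boolAlg => exist (@preserves_joins (ba_of_oo (oo_of_ba A)) A)
                 (fun x => x) (fun _ _ _ px => px)).
  split=> [A|A B f]; last exact: eq_exist.
  exists (exist (@preserves_joins A (ba_of_oo (oo_of_ba A)))
                 (fun x => x) (fun _ _ _ px => px)).
  by split; exact: eq_exist.
(* Here the round trip replaces the given overlap by nonzero meet; [is_ooMorP] reduces the morphism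
   condition to joins, which depend on the order alone. *)
exists (fun P : ooLat => exist (@is_ooMor (oo_of_ba (ba_of_oo P)) P) (fun x => x)
   (proj2 (@is_ooMorP (oo_of_ba (ba_of_oo P)) P (fun x => x)) (fun _ _ _ px => px))).
split=> [P|P Q f]; last exact: eq_exist.
exists (exist (@is_ooMor P (oo_of_ba (ba_of_oo P))) (fun x => x)
   (proj2 (@is_ooMorP P (oo_of_ba (ba_of_oo P)) (fun x => x)) (fun _ _ _ px => px))).
by split; exact: eq_exist.
Qed.
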